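(* Let $\sharp\in\{b,d,v,s\}$ and let $\mathcal T$ be a triangulated category (strongly triangulated if $\sharp=s$). Suppose we have two $\sharp$-coherent $3\times3$ diagrams, $j=1,2$, over the same nine objects $X',X,X'',Y',Y,Y'',Z',Z,Z''$, with rows the $\sharp$-triangles $$X'\xrightarrow{f^X_j}X\xrightarrow{i^X_j}X''\xrightarrow{q^X_j}\Sigma X',\quad Y'\xrightarrow{f^Y_j}Y\xrightarrow{i^Y_j}Y''\xrightarrow{q^Y_j}\Sigma Y',\quad Z'\xrightarrow{f^Z_j}Z\xrightarrow{i^Z_j}Z''\xrightarrow{q^Z_j}\Sigma Z'$$ and columns the $\sharp$-triangles $$X'\xrightarrow{f'_j}Y'\xrightarrow{i'_j}Z'\xrightarrow{q'_j}\Sigma X',\quad X\xrightarrow{f_j}Y\xrightarrow{i_j}Z\xrightarrow{q_j}\Sigma X,\quad X''\xrightarrow{f''_j}Y''\xrightarrow{i''_j}Z''\xrightarrow{q''_j}\Sigma X''.$$ Denote by $\rho^X,\rho^Y,\rho^Z\in K_1({}^\sharp\mathcal T)$ the elements of the pairs of row triangles, and by $\kappa',\kappa,\kappa''\in K_1({}^\sharp\mathcal T)$ the elements of the pairs of column triangles $X'\to Y'\to Z'$, $X\to Y\to Z$, $X''\to Y''\to Z''$, where the element of a pair $(\Delta_1,\Delta_2)$ ($j=1,2$) is $-[\Delta_1]+[\Delta_2]$. Then in $K_1({}^\sharp\mathcal T)$ $$\rho^X-\rho^Y+\rho^Z=\kappa'-\kappa+\kappa''.$$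
   Context: Stable quadratic modules. Groups are additive, $[x,y]=-x-y+x+y$. A stable quadratic module $C_*$ consists of homomorphisms $C_0^{ab}\otimes C_0^{ab}\xrightarrow{\langle\cdot,\cdot\rangle}C_1\xrightarrow{\partial}C_0$ with $\langle c_0,c_0'\rangle+\langle c_0',c_0\rangle=0$, $\partial\langle c_0,c_0'\rangle=[c_0',c_0]$, $\langle\partial c_1,\partial c_1'\rangle=[c_1',c_1]$; $C_0$ acts on $C_1$ by $c_1^{c_0}=c_1+\langle c_0,\partial c_1\rangle$; $\pi_1C_*=\ker\partial$. Presentations by generators in degrees $0,1$ and relations have the evident universal property (morphisms: pairs of homomorphisms compatible with $\partial$ and bracket). Triangles. $\mathcal T$ has suspension $\Sigma$ and chosen zero object $0$. A triangle is $X\xrightarrow fY\xrightarrow iC\xrightarrow q\Sigma X$ with consecutive composites (also $(\Sigma f)q$) zero. An octahedral diagram on $X\xrightarrow fY\xrightarrow gZ$ consists of triangles $\Delta_f\colon X\xrightarrow{f}Y\xrightarrow{i^f}C^f\xrightarrow{q^f}\Sigma X$, $\Delta_g\colon Y\xrightarrow{g}Z\xrightarrow{i^g}C^g\xrightarrow{q^g}\Sigma Y$, $\Delta_{gf}\colon X\xrightarrow{gf}Z\xrightarrow{i^{gf}}C^{gf}\xrightarrow{q^{gf}}\Sigma X$, $\widetilde\Delta\colon C^f\xrightarrow{\bar g}C^{gf}\xrightarrow{\bar f}C^g\xrightarrow{(\Sigma i^f)q^g}\Sigma C^f$ with $\bar g i^f=i^{gf}g$, $q^{gf}\bar g=q^f$,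 $\bar f i^{gf}=i^g$, $q^g\bar f=(\Sigma f)q^{gf}$. It is an (ordinary) octahedron if all four triangles are distinguished; special if moreover $Y\xrightarrow{(g,-i^f)}Z\oplus C^f\xrightarrow{(i^{gf},\bar g)}C^{gf}\xrightarrow{q^g\bar f}\Sigma Y$ and $C^{gf}\xrightarrow{(q^{gf},-\bar f)}\Sigma X\oplus C^g\xrightarrow{(\Sigma f,q^g)}\Sigma Y\xrightarrow{\Sigma(\bar g i^f)}\Sigma C^{gf}$ are distinguished. Contractible triangles are direct sums of triangles $A\xrightarrow1A\to0\to\Sigma A$, $0\to B\xrightarrow1B\to0$, $C\to0\to\Sigma C\xrightarrow1\Sigma C$. A triangle is virtual if its sum with some contractible triangle is isomorphic to some $(f',i',q')$ such that there are distinguished triangles $(f'',i',q')$, $(f',i'',q')$, $(f',i',q'')$ on the same objects. A virtual octahedron is an octahedral diagram whose four triangles are virtual. A strongly triangulated category (Maltsiniotis) is a triangulated category with distinguished $n$-triangles for all $n$ satisfying axioms generalizing those for distinguished triangles; only its distinguished octahedra ($3$-triangles) matter here: a family of octahedra closed under isomorphisms and finite direct sums, containing degenerate octahedra, such that every composable pair completes to one, and morphisms between bases extend. A $\sharp$-triangle is a distinguished triangle if $\sharp=b,d,s$ and a virtual triangle if $\sharp=v$; a $\sharp$-octahedron is an ordinary, special, virtual, distinguished octahedron for $\sharp=b,d,v,s$ respectively. $3\times3$ diagrams. A $3\times3$ diagram consists of $\sharp$-triangles (rows) $(f^X,i^X,q^X)$, $(f^Y,i^Y,q^Y)$, $(f^Z,i^Z,q^Z)$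 on $X',X,X''$; $Y',Y,Y''$; $Z',Z,Z''$, and (columns) $(f',i',q')$, $(f,i,q)$, $(f'',i'',q'')$ on $X',Y',Z'$; $X,Y,Z$; $X'',Y'',Z''$, such that all squares commute: $ff^X=f^Yf'$, $f''i^X=i^Yf$, $(\Sigma f')q^X=q^Yf''$, $if^Y=f^Zi'$, $i''i^Y=i^Zi$, $(\Sigma i')q^Y=q^Zi''$, $qf^Z=(\Sigma f^X)q'$, $q''i^Z=(\Sigma i^X)q$, except that the bottom right one anticommutes: $(\Sigma q')q^Z+(\Sigma q^X)q''=0$. It is $\sharp$-coherent if there are an object $W$ and morphisms $\bar f'\colon X\to W$, $\bar f^X\colon Y'\to W$, $\delta\colon X'\to W$, $\bar i^X\colon W\to X''$, $\bar i'\colon W\to Z'$, $\varepsilon\colon W\to Y$, $\kappa\colon Z''\to\Sigma W$ such that the following four are $\sharp$-octahedra: (O1) on $X'\xrightarrow{f^X}X\xrightarrow{\bar f'}W$ with composite $\delta$, triangles $(f^X,i^X,q^X)$; $X\xrightarrow{\bar f'}W\xrightarrow{\bar i'}Z'\xrightarrow{(\Sigma f^X)q'}\Sigma X$; $X'\xrightarrow{\delta}W\xrightarrow{(\bar i^X,\bar i')}X''\oplus Z'\xrightarrow{(q^X,q')}\Sigma X'$; and $X''\to X''\oplus Z'\to Z'\xrightarrow0\Sigma X''$ (inclusion and projection); (O2) on $X'\xrightarrow{f'}Y'\xrightarrow{\bar f^X}W$ with composite $\delta$, triangles $(f',i',q')$; $Y'\xrightarrow{\bar f^X}W\xrightarrow{\bar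 i^X}X''\xrightarrow{(\Sigma f')q^X}\Sigma Y'$; the same triangle on $\delta$ as in (O1); and $Z'\to X''\oplus Z'\to X''\xrightarrow0\Sigma Z'$; (O3) on $X\xrightarrow{\bar f'}W\xrightarrow{\varepsilon}Y$ with composite $f$, triangles $X\to W\to Z'\to\Sigma X$ as in (O1); $W\xrightarrow{\varepsilon}Y\xrightarrow{i^Zi}Z''\xrightarrow{\kappa}\Sigma W$; $(f,i,q)$; and $(f^Z,i^Z,q^Z)$; (O4) on $Y'\xrightarrow{\bar f^X}W\xrightarrow{\varepsilon}Y$ with composite $f^Y$, triangles $Y'\to W\to X''\to\Sigma Y'$ as in (O2); $W\xrightarrow{\varepsilon}Y\xrightarrow{i''i^Y}Z''\xrightarrow{\kappa}\Sigma W$; $(f^Y,i^Y,q^Y)$; and $(f'',i'',q'')$. (In each case the triangles are listed in the order $\Delta_f,\Delta_g,\Delta_{gf},\widetilde\Delta$.) $\mathcal D_*({}^\sharp\mathcal T)$ is presented by generators $[X]$ (degree $0$) for each object, $[h]$ (degree $1$) for each isomorphism $h\colon X\to X'$, $[\Delta]$ (degree $1$) for each $\sharp$-triangle $\Delta=(X\to Y\to C\to\Sigma X)$, and relations: $\partial[h]=-[X']+[X]$; $\partial[\Delta]=-[Y]+[C]+[X]$; $[0]=0$; $[1_X]=0$; $[X\xrightarrow1X\to0\to\Sigma X]=0=[0\to X\xrightarrow1X\to0]$; $[kh]=[k]+[h]$; $[a]+[c]^{[X]}=-[\Delta']+[b]+[\Delta]$ for each isomorphism $(a,b,c)\colon\Delta\to\Delta'$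 of $\sharp$-triangles; $[\Delta_g]+[\Delta_f]=[\Delta_{gf}]+[\widetilde\Delta]^{[X]}$ for each $\sharp$-octahedron; $\langle[X],[Y]\rangle=-[\Delta_2]+[\Delta_1]$ with $\Delta_1\colon X\to X\oplus Y\to Y\xrightarrow0\Sigma X$, $\Delta_2\colon Y\to X\oplus Y\to X\xrightarrow0\Sigma Y$. $K_1({}^\sharp\mathcal T)$ is identified with $\pi_1\mathcal D_*({}^\sharp\mathcal T)$. *)

(* Defs.v *)
From HB Require Import structures.
From mathcomp Require Import all_boot all_algebra.
From mathcomp Require Import boolp.

Set Implicit Arguments.
Unset Strict Implicit.
Unset Printing Implicit Defensive.

Import GRing.Theory.

(* MathComp writes non-commutative groups multiplicatively, so 1, x * y, x^-1
   and [~ x, y] = x^-1 * y^-1 * x * y stand for 0, x + y, -x and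
   [x, y] = -x - y + x + y.

   A homomorphism C_0^ab (x) C_0^ab -> C_1 is the same thing as a map
   C_0 * C_0 -> C_1 multiplicative in each variable: computing
   <x * x', y * y'> in two ways shows that the values of such a map commute, so
   it is trivial on commutators of C_0 and factors through the tensor
   product (sq_brC below). *)
Record sqmod := SQMod {
  sq0 : groupType;
  sq1 : groupType;
  sq_bd : sq1 -> sq0;
  sq_br : sq0 -> sq0 -> sq1;
  sq_bdM : forall x y, sq_bd (x * y)%g = (sq_bd x * sq_bd y)%g;
  sq_brMl : forall x x' y, sq_br (x * x')%g y = (sq_br x y * sq_br x' y)%g;
  sq_brMr : forall x y y', sq_br x (y * y')%g = (sq_br x y * sq_br x y')%g;
  sq_br_anti : forall x y, (sq_br x y * sq_br y x)%g = 1%g;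
  sq_bd_br : forall x y, sq_bd (sq_br x y) = [~ y, x]%g;
  sq_br_bd : forall u v, sq_br (sq_bd u) (sq_bd v) = [~ v, u]%g
}.

Record sqmorph (C D : sqmod) := SQMorph {
  sqm0 : sq0 C -> sq0 D;
  sqm1 : sq1 C -> sq1 D;
  sqm0M : forall x y, sqm0 (x * y)%g = (sqm0 x * sqm0 y)%g;
  sqm1M : forall x y, sqm1 (x * y)%g = (sqm1 x * sqm1 y)%g;
  sqm_bd : forall u, sqm0 (sq_bd u) = sq_bd (sqm1 u);
  sqm_br : forall x y, sqm1 (sq_br x y) = sq_br (sqm0 x) (sqm0 y)
}.

Section SQModTheory.
Variable C : sqmod.
Local Open Scope group_scope.

Lemma sq_brC (x y x' y' : sq0 C) : commute (sq_br x y) (sq_br x' y').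
Proof.
have := sq_brMr (x * x') y' y; rewrite !sq_brMl !sq_brMr -!mulgA => /mulgI.
by rewrite !mulgA => /mulIg.
Qed.

Lemma sq_bd1 : sq_bd 1 = 1 :> sq0 C.
Proof. by apply: (@mulgI _ (sq_bd 1)); rewrite -sq_bdM !mulg1. Qed.

Lemma sq_bdV (u : sq1 C) : sq_bd u^-1 = (sq_bd u)^-1.
Proof. by apply: (@mulgI _ (sq_bd u)); rewrite -sq_bdM !mulgV sq_bd1. Qed.

Lemma sq_br1l (x : sq0 C) : sq_br 1 x = 1.
Proof. by apply: (@mulgI _ (sq_br 1 x)); rewrite -sq_brMl !mulg1. Qed.

Lemma sq_ker_central (u v : sq1 C) : sq_bd u = 1 -> u * v = v * u.
Proof.
by move=> du; apply/esym/commgP; rewrite -sq_br_bd du sq_br1l.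
Qed.

End SQModTheory.

(* pi_1 = ker sq_bd is central, hence commutative, and is written additively. *)
Record pi1 (C : sqmod) := Pi1 { pi1_val : sq1 C; _ : sq_bd pi1_val == 1%g }.

HB.instance Definition _ C := [isSub for @pi1_val C].
HB.instance Definition _ C := [Choice of pi1 C by <:].

Section Pi1.
Variable C : sqmod.
Implicit Types u v w : pi1 C.
Local Open Scope group_scope.

Lemma pi1_valP u : sq_bd (pi1_val u) = 1.
Proof. exact/eqP/(valP u). Qed.

Fact pi1_zero_subproof : sq_bd (1 : sq1 C) == 1.
Proof. by rewrite sq_bd1. Qed.
Fact pi1_opp_subproof u : sq_bd (pi1_val u)^-1 == 1.
Proof. by rewrite sq_bdV pi1_valP invg1. Qed.
Fact pi1_add_subproof u v : sq_bd (pi1_val u * pi1_val v) == 1.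
Proof. by rewrite sq_bdM !pi1_valP mulg1. Qed.

Definition pi1_zero := Pi1 pi1_zero_subproof.
Definition pi1_opp u := Pi1 (pi1_opp_subproof u).
Definition pi1_add u v := Pi1 (pi1_add_subproof u v).

Fact pi1_addA : associative pi1_add.
Proof. by move=> u v w; apply/val_inj/mulgA. Qed.
Fact pi1_addC : commutative pi1_add.
Proof. by move=> u v; apply/val_inj/sq_ker_central/pi1_valP. Qed.
Fact pi1_add0 : left_id pi1_zero pi1_add.
Proof. by move=> u; apply/val_inj/mul1g. Qed.
Fact pi1_addN : left_inverse pi1_zero pi1_opp pi1_add.
Proof. by move=> u; apply/val_inj/mulVg. Qed.

HB.instance Definition _ :=
  GRing.isZmodule.Build (pi1 C) pi1_addA pi1_addC pi1_add0 pi1_addN.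

End Pi1.

(* Words of degree 0 (index false) and degree 1 (index true). *)
Inductive word (G0 G1 : Type) : bool -> Type :=
| Gen0 of G0 : word G0 G1 false
| Gen1 of G1 : word G0 G1 true
| Zero d : word G0 G1 d
| Opp d of word G0 G1 d : word G0 G1 d
| Add d of word G0 G1 d & word G0 G1 d : word G0 G1 d
| Bd of word G0 G1 true : word G0 G1 false
| Br of word G0 G1 false & word G0 G1 false : word G0 G1 true.

Arguments Zero {G0 G1 d}.
Arguments Gen0 {G0 G1}.
Arguments Gen1 {G0 G1}.

Declare Scope word_scope.
Delimit Scope word_scope with W.
Bind Scope word_scope with word.
Notation "0" := Zero : word_scope.
Notation "- u" := (Opp u) : word_scope.
Notation "u + v" := (Add u v) : word_scope.
Notation "⟨ u , v ⟩" := (Br u v) (at level 0, u, v at level 99) : word_scope.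
(* The action c_1 ^ c_0 = c_1 + <c_0, bd c_1>. *)
Notation "u ^ x" := (u + Br x (Bd u))%W : word_scope.

Definition sqdeg (C : sqmod) (d : bool) : groupType := if d then sq1 C else sq0 C.

Section Presentation.

Record presentation := Presentation {
  gens0 : Type;
  gens1 : Type;
  rels : forall d, word gens0 gens1 d -> word gens0 gens1 d -> Prop
}.

Fixpoint eval G0 G1 (C : sqmod) (g0 : G0 -> sq0 C) (g1 : G1 -> sq1 C) d
    (w : word G0 G1 d) : sqdeg C d :=
  match w in word _ _ d return sqdeg C d with
  | Gen0 x => g0 x
  | Gen1 x => g1 x
  | Zero d => 1%g
  | Opp d u => (eval g0 g1 u)^-1%g
  | Add d u v => (eval g0 g1 u * eval g0 g1 v)%g
  | Bd u => sq_bd (eval g0 g1 u : sq1 C)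
  | Br x y => sq_br (eval g0 g1 x : sq0 C) (eval g0 g1 y : sq0 C)
  end.

Variable P : presentation.

Definition satisfies (C : sqmod) (g0 : gens0 P -> sq0 C) (g1 : gens1 P -> sq1 C) :=
  forall d (u v : word _ _ d), rels u v -> eval g0 g1 u = eval g0 g1 v.

(* The congruence generated by the relations and the axioms of stable
   quadratic modules, in its semantic form. The quotient of the words by it
   has the universal property of the presentation: see presentedP. *)
Definition word_equiv d (u v : word (gens0 P) (gens1 P) d) : Prop :=
  forall (C : sqmod) (g0 : gens0 P -> sq0 C) (g1 : gens1 P -> sq1 C),
    satisfies g0 g1 -> eval g0 g1 u = eval g0 g1 v.

HB.instance Definition _ G0 G1 d := gen_eqMixin (word G0 G1 d).
HB.instance Definition _ G0 G1 d := gen_choiceMixin (word G0 G1 d).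

Definition word_eq d : rel (word (gens0 P) (gens1 P) d) :=
  fun u v => `[< word_equiv u v >].

Fact word_eq_refl d : reflexive (@word_eq d).
Proof. by move=> u; apply/asboolP. Qed.
Fact word_eq_sym d : symmetric (@word_eq d).
Proof.
have h u v : word_eq u v -> @word_eq d v u.
  by move=> /asboolP e; apply/asboolP => C g0 g1 s; rewrite (e C g0 g1 s).
by move=> u v; apply/idP/idP; apply: h.
Qed.
Fact word_eq_trans d : transitive (@word_eq d).
Proof.
move=> v u w /asboolP e /asboolP f; apply/asboolP => C g0 g1 s.
by rewrite (e C g0 g1 s) (f C g0 g1 s).
Qed.

Canonical word_eq_equiv d :=
  EquivRel (@word_eq d) (@word_eq_refl d) (@word_eq_sym d) (@word_eq_trans d).

Local Open Scope quotient_scope.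

Definition wclass d := {eq_quot (@word_eq d)}.
HB.instance Definition _ d := Choice.on (wclass d).
HB.instance Definition _ d := Quotient.on (wclass d).

Definition cls d (u : word (gens0 P) (gens1 P) d) : wclass d := \pi_(wclass d) u.
Arguments cls {d}.

Lemma clsP d (u v : word _ _ d) : cls u = cls v <-> word_equiv u v.
Proof.
by split=> [/eqmodP/asboolP//|e]; apply/eqmodP/asboolP.
Qed.

Lemma clsW d (Q : wclass d -> Prop) : (forall u, Q (cls u)) -> forall x, Q x.
Proof. by move=> h x; rewrite -[x]reprK; apply: h. Qed.

Lemma repr_cls d (u : word _ _ d) : word_equiv (repr (cls u)) u.
Proof. by apply/clsP; rewrite /cls reprK. Qed.

Definition wc_one d : wclass d := cls 0%W.
Definition wc_inv d (x : wclass d) : wclass d := cls (- repr x)%W.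
Definition wc_mul d (x y : wclass d) : wclass d := cls (repr x + repr y)%W.
Definition wc_bd (x : wclass true) : wclass false := cls (Bd (repr x)).
Definition wc_br (x y : wclass false) : wclass true := cls ⟨repr x, repr y⟩%W.

Lemma wc_invE d (u : word _ _ d) : wc_inv (cls u) = cls (- u)%W.
Proof. by apply/clsP => C g0 g1 s /=; rewrite (repr_cls u s). Qed.
Lemma wc_mulE d (u v : word _ _ d) : wc_mul (cls u) (cls v) = cls (u + v)%W.
Proof. by apply/clsP => C g0 g1 s /=; rewrite (repr_cls u s) (repr_cls v s). Qed.
Lemma wc_bdE u : wc_bd (cls u) = cls (Bd u).
Proof. by apply/clsP => C g0 g1 s /=; rewrite (repr_cls u s). Qed.
Lemma wc_brE u v : wc_br (cls u) (cls v) = cls ⟨u, v⟩%W.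
Proof. by apply/clsP => C g0 g1 s /=; rewrite (repr_cls u s) (repr_cls v s). Qed.

Fact wc_mulA d : associative (@wc_mul d).
Proof.
elim/clsW=> u; elim/clsW=> v; elim/clsW=> w; rewrite !wc_mulE.
by apply/clsP => C g0 g1 s /=; rewrite mulgA.
Qed.
Fact wc_mul1 d : left_id (wc_one d) (@wc_mul d).
Proof. by elim/clsW=> u; rewrite wc_mulE; apply/clsP => C g0 g1 s; apply: mul1g. Qed.
Fact wc_mulr1 d : right_id (wc_one d) (@wc_mul d).
Proof. by elim/clsW=> u; rewrite wc_mulE; apply/clsP => C g0 g1 s; apply: mulg1. Qed.
Fact wc_mulV d : left_inverse (wc_one d) (@wc_inv d) (@wc_mul d).
Proof.
by elim/clsW=> u; rewrite wc_invE wc_mulE; apply/clsP => C g0 g1 s; apply: mulVg.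
Qed.
Fact wc_mulrV d : right_inverse (wc_one d) (@wc_inv d) (@wc_mul d).
Proof.
by elim/clsW=> u; rewrite wc_invE wc_mulE; apply/clsP => C g0 g1 s; apply: mulgV.
Qed.

HB.instance Definition _ d := isGroup.Build (wclass d)
  (@wc_mulA d) (@wc_mul1 d) (@wc_mulr1 d) (@wc_mulV d) (@wc_mulrV d).

Lemma cls1 d : cls 0%W = 1%g :> wclass d. Proof. by []. Qed.
Lemma clsV d (u : word _ _ d) : cls (- u)%W = (cls u)^-1%g.
Proof. by rewrite -wc_invE. Qed.
Lemma clsM d (u v : word _ _ d) : cls (u + v)%W = (cls u * cls v)%g.
Proof. by rewrite -wc_mulE. Qed.

Lemma clsR d (u v : word _ _ d) :
  cls (- u + (- v + (u + v)))%W = [~ cls u, cls v]%g.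
Proof. by rewrite !clsM !clsV. Qed.

Fact wc_bdM (x y : wclass true) : wc_bd (x * y)%g = (wc_bd x * wc_bd y)%g.
Proof.
elim/clsW: x => u; elim/clsW: y => v; rewrite -clsM !wc_bdE -clsM.
by apply/clsP => C g0 g1 s; apply: sq_bdM.
Qed.
Fact wc_brMl (x x' y : wclass false) :
  wc_br (x * x')%g y = (wc_br x y * wc_br x' y)%g.
Proof.
elim/clsW: x => u; elim/clsW: x' => u'; elim/clsW: y => v.
rewrite -clsM !wc_brE -clsM.
by apply/clsP => C g0 g1 s; apply: sq_brMl.
Qed.
Fact wc_brMr (x y y' : wclass false) :
  wc_br x (y * y')%g = (wc_br x y * wc_br x y')%g.
Proof.
elim/clsW: x => u; elim/clsW: y => v; elim/clsW: y' => v'.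
rewrite -clsM !wc_brE -clsM.
by apply/clsP => C g0 g1 s; apply: sq_brMr.
Qed.
Fact wc_br_anti (x y : wclass false) : (wc_br x y * wc_br y x)%g = 1%g.
Proof.
elim/clsW: x => u; elim/clsW: y => v; rewrite !wc_brE -clsM -cls1.
by apply/clsP => C g0 g1 s; apply: sq_br_anti.
Qed.
Fact wc_bd_br (x y : wclass false) : wc_bd (wc_br x y) = [~ y, x]%g.
Proof.
elim/clsW: x => u; elim/clsW: y => v.
rewrite !wc_brE wc_bdE -clsR.
by apply/clsP => C g0 g1 s; apply: sq_bd_br.
Qed.
Fact wc_br_bd (x y : wclass true) : wc_br (wc_bd x) (wc_bd y) = [~ y, x]%g.
Proof.
elim/clsW: x => u; elim/clsW: y => v.
rewrite !wc_bdE wc_brE -clsR.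
by apply/clsP => C g0 g1 s; apply: sq_br_bd.
Qed.

Definition presented : sqmod :=
  SQMod wc_bdM wc_brMl wc_brMr wc_br_anti wc_bd_br wc_br_bd.

Definition pgen0 (x : gens0 P) : sq0 presented := cls (Gen0 x).
Definition pgen1 (x : gens1 P) : sq1 presented := cls (Gen1 x).

Lemma eval_presented d (u : word (gens0 P) (gens1 P) d) :
  eval pgen0 pgen1 u = (if d return wclass d -> sqdeg presented d
                        then id else id) (cls u).
Proof.
elim: {d} u => [x|x|d|d u IHu|d u IHu v IHv|u IHu|u IHu v IHv] //=.
- by case: d.
- by rewrite IHu clsV; case: d u {IHu}.
- by rewrite IHu IHv clsM; case: d u v {IHu IHv}.
- by rewrite IHu wc_bdE.
- by rewrite IHu IHv wc_brE.
Qed.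

Lemma presented_satisfies : satisfies pgen0 pgen1.
Proof.
move=> d u v ruv; rewrite !eval_presented; congr (_ _); apply/clsP.
by move=> C g0 g1; apply.
Qed.

Lemma presentedP (C : sqmod) (g0 : gens0 P -> sq0 C) (g1 : gens1 P -> sq1 C) :
  satisfies g0 g1 ->
  exists m : sqmorph presented C,
    [/\ forall x, sqm0 m (pgen0 x) = g0 x, forall x, sqm1 m (pgen1 x) = g1 x
      & forall m' : sqmorph presented C,
          (forall x, sqm0 m' (pgen0 x) = g0 x) ->
          (forall x, sqm1 m' (pgen1 x) = g1 x) ->
          sqm0 m' =1 sqm0 m /\ sqm1 m' =1 sqm1 m].
Proof.
move=> s.
pose e d (x : wclass d) : sqdeg C d := eval g0 g1 (repr x).
have eE d u : e d (cls u) = eval g0 g1 u by apply: repr_cls.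
have eM d x y : e d (x * y)%g = (e d x * e d y)%g.
  by elim/clsW: x => u; elim/clsW: y => v; rewrite -clsM !eE.
have ebd x : e false (wc_bd x) = sq_bd (e true x : sq1 C).
  by elim/clsW: x => u; rewrite wc_bdE !eE.
have ebr x y : e true (wc_br x y) = sq_br (e false x : sq0 C) (e false y).
  by elim/clsW: x => u; elim/clsW: y => v; rewrite wc_brE !eE.
exists (@SQMorph presented C (e false) (e true) (@eM false) (@eM true) ebd ebr).
split=> [x|x|m' h0 h1] /=; rewrite ?eE //.
pose f d : wclass d -> sqdeg C d :=
  if d return wclass d -> sqdeg C d then sqm1 m' else sqm0 m'.
have fM d x y : f d (x * y)%g = (f d x * f d y)%g.
  by case: d x y => x y; [apply: (sqm1M m')|apply: (sqm0M m')].
have f1 d : f d 1%g = 1%g.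
  by apply: (@mulgI _ (f d 1%g)); rewrite -fM !mulg1.
have fV d x : f d x^-1%g = (f d x)^-1%g.
  by apply: (@mulgI _ (f d x)); rewrite -fM !mulgV f1.
have fE d u : f d (cls u) = eval g0 g1 u.
  elim: {d} u => [x|x|d|d u IHu|d u IHu v IHv|u IHu|u IHu v IHv] /=.
  - exact: h0.
  - exact: h1.
  - exact: f1.
  - by rewrite clsV fV IHu.
  - by rewrite clsM fM IHu IHv.
  - by rewrite -wc_bdE -IHu; apply: (sqm_bd m').
  - by rewrite -wc_brE -IHu -IHv; apply: (sqm_br m').
by split; elim/clsW=> u; rewrite /= eE; [apply: (fE false)|apply: (fE true)].
Qed.

End Presentation.

Arguments cls {P d}.

Record additive_cat := AdditiveCat {
  obj :> Type;
  hom : obj -> obj -> zmodType;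
  idm : forall X, hom X X;
  comp : forall X Y Z, hom Y Z -> hom X Y -> hom X Z;
  compA : forall X Y Z W (h : hom Z W) (g : hom Y Z) (f : hom X Y),
    comp h (comp g f) = comp (comp h g) f;
  comp1m : forall X Y (f : hom X Y), comp (idm Y) f = f;
  compm1 : forall X Y (f : hom X Y), comp f (idm X) = f;
  compDl : forall X Y Z (g g' : hom Y Z) (f : hom X Y),
    comp (g + g')%R f = (comp g f + comp g' f)%R;
  compDr : forall X Y Z (g : hom Y Z) (f f' : hom X Y),
    comp g (f + f')%R = (comp g f + comp g f')%R;
  zob : obj;
  zobP : idm zob = 0%R;
  dsum : obj -> obj -> obj;
  in1 : forall X Y, hom X (dsum X Y);
  in2 : forall X Y, hom Y (dsum X Y);
  pr1 : forall X Y, hom (dsum X Y) X;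
  pr2 : forall X Y, hom (dsum X Y) Y;
  pr1_in1 : forall X Y, comp (pr1 X Y) (in1 X Y) = idm X;
  pr2_in2 : forall X Y, comp (pr2 X Y) (in2 X Y) = idm Y;
  pr1_in2 : forall X Y, comp (pr1 X Y) (in2 X Y) = 0%R;
  pr2_in1 : forall X Y, comp (pr2 X Y) (in1 X Y) = 0%R;
  dsum_id : forall X Y,
    (comp (in1 X Y) (pr1 X Y) + comp (in2 X Y) (pr2 X Y))%R = idm (dsum X Y)
}.

Arguments hom {_} _ _.
Arguments idm {_} X.
Arguments comp {_ X Y Z} _ _.
Arguments zob {_}.
Arguments dsum {_} _ _.
Arguments in1 {_} X Y.
Arguments in2 {_} X Y.
Arguments pr1 {_} X Y.
Arguments pr2 {_} X Y.

Declare Scope cat_scope.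
Delimit Scope cat_scope with cat.
Local Open Scope ring_scope.
Local Open Scope cat_scope.

Notation "g ∘ f" := (comp g f) (at level 40, left associativity) : cat_scope.
Notation "X ⊕ Y" := (dsum X Y) (at level 50, left associativity) : cat_scope.

Section Additive.
Variable T : additive_cat.
Implicit Types X Y Z W : T.

(* col_m f g and row_m f g are both written (f, g) in the literature. *)
Definition col_m W X Y (f : hom W X) (g : hom W Y) : hom W (X ⊕ Y) :=
  in1 X Y ∘ f + in2 X Y ∘ g.

Definition row_m X Y W (f : hom X W) (g : hom Y W) : hom (X ⊕ Y) W :=
  f ∘ pr1 X Y + g ∘ pr2 X Y.

Definition diag_m X Y X1 Y1 (f : hom X X1) (g : hom Y Y1) :
    hom (X ⊕ Y) (X1 ⊕ Y1) :=
  in1 X1 Y1 ∘ f ∘ pr1 X Y + in2 X1 Y1 ∘ g ∘ pr2 X Y.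

Record iso X Y := Iso {
  fwd : hom X Y;
  bwd : hom Y X;
  bwdK : bwd ∘ fwd = idm X;
  fwdK : fwd ∘ bwd = idm Y
}.

Definition iso_id X : iso X X := Iso (comp1m (idm X)) (comp1m (idm X)).

Fact iso_comp_subproof X Y Z (k : iso Y Z) (h : iso X Y) :
  (bwd h ∘ bwd k) ∘ (fwd k ∘ fwd h) = idm X.
Proof. by rewrite compA -(compA (bwd h)) bwdK compm1 bwdK. Qed.

Fact iso_comp_subproof' X Y Z (k : iso Y Z) (h : iso X Y) :
  (fwd k ∘ fwd h) ∘ (bwd h ∘ bwd k) = idm Z.
Proof. by rewrite compA -(compA (fwd k)) fwdK compm1 fwdK. Qed.

Definition iso_comp X Y Z (k : iso Y Z) (h : iso X Y) : iso X Z :=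
  Iso (iso_comp_subproof k h) (iso_comp_subproof' k h).

End Additive.

Record suspended_cat := SuspendedCat {
  susp_base :> additive_cat;
  susp : susp_base -> susp_base;
  suspm : forall X Y : susp_base, hom X Y -> hom (susp X) (susp Y);
  suspm1 : forall X : susp_base, suspm (idm X) = idm (susp X);
  suspmM : forall (X Y Z : susp_base) (g : hom Y Z) (f : hom X Y),
    suspm (g ∘ f) = suspm g ∘ suspm f;
  suspmD : forall (X Y : susp_base) (f f' : hom X Y),
    suspm (f + f') = suspm f + suspm f';
  suspm_inj : forall X Y : susp_base, injective (@suspm X Y);
  suspm_full : forall (X Y : susp_base) (g : hom (susp X) (susp Y)),
    exists f : hom X Y, suspm f = g;
  susp_esurj : forall Y : susp_base, exists X, inhabited (iso (susp X) Y)
}.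

Arguments susp {_} _.
Arguments suspm {_ X Y} _.

Notation "'Σ' X" := (susp X) (at level 30, right associativity) : cat_scope.
Notation "'Σₘ' f" := (suspm f) (at level 30, right associativity) : cat_scope.

Section Triangles.
Variable T : suspended_cat.
Implicit Types X Y Z C : T.

Record tri X Y C := Tri {
  tf : hom X Y;
  ti : hom Y C;
  tq : hom C (Σ X)
}.

Definition is_triangle X Y C (D : tri X Y C) : Prop :=
  [/\ ti D ∘ tf D = 0, tq D ∘ ti D = 0 & Σₘ (tf D) ∘ tq D = 0].

Definition tri_morph X Y C X1 Y1 C1 (D : tri X Y C) (D1 : tri X1 Y1 C1)
    (a : hom X X1) (b : hom Y Y1) (c : hom C C1) : Prop :=
  [/\ b ∘ tf D = tf D1 ∘ a, c ∘ ti D = ti D1 ∘ b & Σₘ a ∘ tq D = tq D1 ∘ c].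

Definition tri_isom X Y C X1 Y1 C1 (D : tri X Y C) (D1 : tri X1 Y1 C1) : Prop :=
  exists (a : iso X X1) (b : iso Y Y1) (c : iso C C1),
    tri_morph D D1 (fwd a) (fwd b) (fwd c).

Definition tri_id1 X : tri X X zob := Tri (idm X) 0 0.
(* Σ0 is a zero object, but need not be the chosen one. *)
Definition tri_id2 X : tri zob X X := Tri 0 (idm X) 0.
Definition tri_id3 X : tri X zob (Σ X) := Tri 0 0 (idm (Σ X)).

Definition tri_rot X Y C (D : tri X Y C) : tri Y C (Σ X) :=
  Tri (ti D) (tq D) (- Σₘ (tf D)).

(* The third morphism is the diagonal one followed by the canonical
   isomorphism of ΣX ⊕ ΣX1 with Σ(X ⊕ X1). *)
Definition tri_dsum X Y C X1 Y1 C1 (D : tri X Y C) (D1 : tri X1 Y1 C1) :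
    tri (X ⊕ X1) (Y ⊕ Y1) (C ⊕ C1) :=
  Tri (diag_m (tf D) (tf D1)) (diag_m (ti D) (ti D1))
      (row_m (Σₘ (in1 X X1) ∘ tq D) (Σₘ (in2 X X1) ∘ tq D1)).

Definition tri_split X Y : tri X (X ⊕ Y) Y := Tri (in1 X Y) (pr2 X Y) 0.
Definition tri_split' X Y : tri Y (X ⊕ Y) X := Tri (in2 X Y) (pr1 X Y) 0.

(* Octahedral diagrams are given by their four triangles: the two morphisms
   of the base are those of Df and Dg, and the two remaining morphisms
   \bar g and \bar f are the first two of Dt. *)
Definition octahedral_diagram X Y Z Cf Cg Cgf (Df : tri X Y Cf) (Dg : tri Y Z Cg)
    (Dgf : tri X Z Cgf) (Dt : tri Cf Cgf Cg) : Prop :=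
  [/\ [/\ is_triangle Df, is_triangle Dg, is_triangle Dgf & is_triangle Dt],
      tf Dgf = tf Dg ∘ tf Df,
      tq Dt = Σₘ (ti Df) ∘ tq Dg,
      tf Dt ∘ ti Df = ti Dgf ∘ tf Dg /\ tq Dgf ∘ tf Dt = tq Df
    & ti Dt ∘ ti Dgf = ti Dg /\ tq Dg ∘ ti Dt = Σₘ (tf Df) ∘ tq Dgf].

End Triangles.

Record triangulated_cat := TriangulatedCat {
  tr_base :> suspended_cat;
  distinguished : forall X Y C : tr_base, tri X Y C -> Prop;
  dist_isom : forall (X Y C X1 Y1 C1 : tr_base) (D : tri X Y C) (D1 : tri X1 Y1 C1),
    tri_isom D D1 -> distinguished D -> distinguished D1;
  dist_id : forall X : tr_base, distinguished (tri_id1 X);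
  dist_cone : forall (X Y : tr_base) (f : hom X Y),
    exists (C : tr_base) (i : hom Y C) (q : hom C (Σ X)), distinguished (Tri f i q);
  dist_rot : forall (X Y C : tr_base) (D : tri X Y C),
    distinguished D <-> distinguished (tri_rot D);
  dist_fill : forall (X Y C X1 Y1 C1 : tr_base) (D : tri X Y C) (D1 : tri X1 Y1 C1)
      (a : hom X X1) (b : hom Y Y1),
    distinguished D -> distinguished D1 -> b ∘ tf D = tf D1 ∘ a ->
    exists c, tri_morph D D1 a b c;
  dist_octa : forall (X Y Z Cf Cg Cgf : tr_base)
      (Df : tri X Y Cf) (Dg : tri Y Z Cg) (Dgf : tri X Z Cgf),
    distinguished Df -> distinguished Dg -> distinguished Dgf ->
    tf Dgf = tf Dg ∘ tf Df ->
    exists2 Dt : tri Cf Cgf Cg, distinguished Dt & octahedral_diagram Df Dg Dgf Dt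
}.

Section Octahedra.
Variable T : triangulated_cat.
Implicit Types X Y Z C : T.

Definition octahedron X Y Z Cf Cg Cgf (Df : tri X Y Cf) (Dg : tri Y Z Cg)
    (Dgf : tri X Z Cgf) (Dt : tri Cf Cgf Cg) : Prop :=
  octahedral_diagram Df Dg Dgf Dt /\
  [/\ distinguished Df, distinguished Dg, distinguished Dgf & distinguished Dt].

Definition special_octahedron X Y Z Cf Cg Cgf (Df : tri X Y Cf) (Dg : tri Y Z Cg)
    (Dgf : tri X Z Cgf) (Dt : tri Cf Cgf Cg) : Prop :=
  [/\ octahedron Df Dg Dgf Dt,
      distinguished (Tri (col_m (tf Dg) (- ti Df)) (row_m (ti Dgf) (tf Dt))
                         (tq Dg ∘ ti Dt))
    & distinguished (Tri (col_m (tq Dgf) (- ti Dt)) (row_m (Σₘ (tf Df)) (tq Dg))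
                         (Σₘ (tf Dt ∘ ti Df)))].

Definition contractible X Y C (D : tri X Y C) : Prop :=
  exists A B E : T, tri_isom D (tri_dsum (tri_dsum (tri_id1 A) (tri_id2 B)) (tri_id3 E)).

Definition virtual X Y C (D : tri X Y C) : Prop :=
  is_triangle D /\
  exists (X0 Y0 C0 X1 Y1 C1 : T) (K : tri X0 Y0 C0) (D1 : tri X1 Y1 C1),
    [/\ contractible K, tri_isom (tri_dsum D K) D1
      & [/\ exists f, distinguished (Tri f (ti D1) (tq D1)),
            exists i, distinguished (Tri (tf D1) i (tq D1))
          & exists q, distinguished (Tri (tf D1) (ti D1) q)]].

Definition virtual_octahedron X Y Z Cf Cg Cgf (Df : tri X Y Cf) (Dg : tri Y Z Cg)
    (Dgf : tri X Z Cgf) (Dt : tri Cf Cgf Cg) : Prop :=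
  octahedral_diagram Df Dg Dgf Dt /\
  [/\ virtual Df, virtual Dg, virtual Dgf & virtual Dt].

(* The part of a strong triangulation in the sense of Maltsiniotis that concerns
   the distinguished 3-triangles (octahedra), the only ones used here. The
   degenerate octahedra are those on the bases X -1-> X -f-> Y, X -f-> Y -1-> Y
   and 0 --> X -f-> Y obtained from a distinguished triangle on f. *)
Record strong_triangulation := StrongTriangulation {
  dist_octahedron : forall X Y Z Cf Cg Cgf : T,
    tri X Y Cf -> tri Y Z Cg -> tri X Z Cgf -> tri Cf Cgf Cg -> Prop;
  so_octahedron : forall (X Y Z Cf Cg Cgf : T) (Df : tri X Y Cf) (Dg : tri Y Z Cg)
      (Dgf : tri X Z Cgf) (Dt : tri Cf Cgf Cg),
    dist_octahedron Df Dg Dgf Dt -> octahedron Df Dg Dgf Dt;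
  so_isom : forall (X Y Z Cf Cg Cgf : T) (Df : tri X Y Cf) (Dg : tri Y Z Cg)
      (Dgf : tri X Z Cgf) (Dt : tri Cf Cgf Cg)
      (X1 Y1 Z1 Cf1 Cg1 Cgf1 : T) (Df1 : tri X1 Y1 Cf1) (Dg1 : tri Y1 Z1 Cg1)
      (Dgf1 : tri X1 Z1 Cgf1) (Dt1 : tri Cf1 Cgf1 Cg1)
      (a : iso X X1) (b : iso Y Y1) (c : iso Z Z1)
      (x : iso Cf Cf1) (y : iso Cg Cg1) (z : iso Cgf Cgf1),
    tri_morph Df Df1 (fwd a) (fwd b) (fwd x) ->
    tri_morph Dg Dg1 (fwd b) (fwd c) (fwd y) ->
    tri_morph Dgf Dgf1 (fwd a) (fwd c) (fwd z) ->
    tri_morph Dt Dt1 (fwd x) (fwd z) (fwd y) ->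
    dist_octahedron Df Dg Dgf Dt -> dist_octahedron Df1 Dg1 Dgf1 Dt1;
  so_dsum : forall (X Y Z Cf Cg Cgf : T) (Df : tri X Y Cf) (Dg : tri Y Z Cg)
      (Dgf : tri X Z Cgf) (Dt : tri Cf Cgf Cg)
      (X1 Y1 Z1 Cf1 Cg1 Cgf1 : T) (Df1 : tri X1 Y1 Cf1) (Dg1 : tri Y1 Z1 Cg1)
      (Dgf1 : tri X1 Z1 Cgf1) (Dt1 : tri Cf1 Cgf1 Cg1),
    dist_octahedron Df Dg Dgf Dt -> dist_octahedron Df1 Dg1 Dgf1 Dt1 ->
    dist_octahedron (tri_dsum Df Df1) (tri_dsum Dg Dg1)
                    (tri_dsum Dgf Dgf1) (tri_dsum Dt Dt1);
  so_degen1 : forall (X Y C : T) (D : tri X Y C), distinguished D ->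
    dist_octahedron (tri_id1 X) D D (tri_id2 C);
  so_degen2 : forall (X Y C : T) (D : tri X Y C), distinguished D ->
    dist_octahedron D (tri_id1 Y) D (tri_id1 C);
  so_degen0 : forall (X Y C : T) (D : tri X Y C), distinguished D ->
    dist_octahedron (tri_id2 X) D (tri_id2 Y) D;
  so_complete : forall (X Y Z : T) (f : hom X Y) (g : hom Y Z),
    exists (Cf Cg Cgf : T) (Df : tri X Y Cf) (Dg : tri Y Z Cg)
        (Dgf : tri X Z Cgf) (Dt : tri Cf Cgf Cg),
      [/\ tf Df = f, tf Dg = g & dist_octahedron Df Dg Dgf Dt];
  so_extend : forall (X Y Z Cf Cg Cgf : T) (Df : tri X Y Cf) (Dg : tri Y Z Cg)
      (Dgf : tri X Z Cgf) (Dt : tri Cf Cgf Cg)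
      (X1 Y1 Z1 Cf1 Cg1 Cgf1 : T) (Df1 : tri X1 Y1 Cf1) (Dg1 : tri Y1 Z1 Cg1)
      (Dgf1 : tri X1 Z1 Cgf1) (Dt1 : tri Cf1 Cgf1 Cg1)
      (a : hom X X1) (b : hom Y Y1) (c : hom Z Z1),
    dist_octahedron Df Dg Dgf Dt -> dist_octahedron Df1 Dg1 Dgf1 Dt1 ->
    b ∘ tf Df = tf Df1 ∘ a -> c ∘ tf Dg = tf Dg1 ∘ b ->
    exists (x : hom Cf Cf1) (y : hom Cg Cg1) (z : hom Cgf Cgf1),
      [/\ tri_morph Df Df1 a b x, tri_morph Dg Dg1 b c y,
          tri_morph Dgf Dgf1 a c z & tri_morph Dt Dt1 x z y]
}.

(* b: distinguished triangles and ordinary octahedra; d: distinguished triangles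
   and special octahedra; v: virtual triangles and virtual octahedra;
   s: distinguished triangles and the octahedra of a strong triangulation. *)
Inductive flavour :=
| flavour_b
| flavour_d
| flavour_v
| flavour_s of strong_triangulation.

Variable sh : flavour.

Definition is_sharp_triangle X Y C (D : tri X Y C) : Prop :=
  match sh with
  | flavour_v => virtual D
  | _ => distinguished D
  end.

Definition sharp_octahedron X Y Z Cf Cg Cgf (Df : tri X Y Cf) (Dg : tri Y Z Cg)
    (Dgf : tri X Z Cgf) (Dt : tri Cf Cgf Cg) : Prop :=
  match sh with
  | flavour_b => octahedron Df Dg Dgf Dt
  | flavour_d => special_octahedron Df Dg Dgf Dt
  | flavour_v => virtual_octahedron Df Dg Dgf Dt
  | flavour_s st => dist_octahedron st Df Dg Dgf Dt
  end.

Record sharp_triangle X Y C := SharpTriangle {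
  st_tri :> tri X Y C;
  _ : is_sharp_triangle st_tri
}.

End Octahedra.

Section DStar.
Variables (T : triangulated_cat) (sh : flavour T).

Inductive D_gen1 : Type :=
| GenIso (X X1 : T) of iso X X1
| GenTri (X Y C : T) of sharp_triangle sh X Y C.

Definition w_ob (X : T) : word T D_gen1 false := Gen0 X.
Definition w_iso (X X1 : T) (h : iso X X1) : word T D_gen1 true := Gen1 (GenIso h).
Definition w_tri (X Y C : T) (D : sharp_triangle sh X Y C) : word T D_gen1 true :=
  Gen1 (GenTri D).

Local Open Scope word_scope.

Inductive D_rel : forall d, word T D_gen1 d -> word T D_gen1 d -> Prop :=
| rel_bd_iso (X X1 : T) (h : iso X X1) :
    D_rel (Bd (w_iso h)) (- w_ob X1 + w_ob X)
| rel_bd_tri (X Y C : T) (D : sharp_triangle sh X Y C) :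
    D_rel (Bd (w_tri D)) (- w_ob Y + w_ob C + w_ob X)
| rel_zob : D_rel (w_ob zob) 0
| rel_iso_id (X : T) : D_rel (w_iso (iso_id X)) 0
| rel_tri_id1 (X : T) (D : sharp_triangle sh X X zob) :
    D = tri_id1 X :> tri _ _ _ -> D_rel (w_tri D) 0
| rel_tri_id2 (X : T) (D : sharp_triangle sh zob X X) :
    D = tri_id2 X :> tri _ _ _ -> D_rel (w_tri D) 0
| rel_iso_comp (X Y Z : T) (k : iso Y Z) (h : iso X Y) :
    D_rel (w_iso (iso_comp k h)) (w_iso k + w_iso h)
| rel_tri_isom (X Y C X1 Y1 C1 : T)
    (D : sharp_triangle sh X Y C) (D1 : sharp_triangle sh X1 Y1 C1)
    (a : iso X X1) (b : iso Y Y1) (c : iso C C1) :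
    tri_morph D D1 (fwd a) (fwd b) (fwd c) ->
    D_rel (w_iso a + w_iso c ^ w_ob X) (- w_tri D1 + w_iso b + w_tri D)
| rel_octahedron (X Y Z Cf Cg Cgf : T)
    (Df : sharp_triangle sh X Y Cf) (Dg : sharp_triangle sh Y Z Cg)
    (Dgf : sharp_triangle sh X Z Cgf) (Dt : sharp_triangle sh Cf Cgf Cg) :
    sharp_octahedron sh Df Dg Dgf Dt ->
    D_rel (w_tri Dg + w_tri Df) (w_tri Dgf + w_tri Dt ^ w_ob X)
| rel_dsum (X Y : T) (D1 : sharp_triangle sh X (X ⊕ Y)%cat Y)
    (D2 : sharp_triangle sh Y (X ⊕ Y)%cat X) :
    D1 = tri_split X Y :> tri _ _ _ -> D2 = tri_split' X Y :> tri _ _ _ ->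
    D_rel ⟨w_ob X, w_ob Y⟩ (- w_tri D2 + w_tri D1).

Definition D_pres : presentation := Presentation D_rel.

Definition D_star : sqmod := presented D_pres.

Definition K1 : zmodType := pi1 D_star.

Definition tri_class (X Y C : T) (D : sharp_triangle sh X Y C) : sq1 D_star :=
  cls (w_tri D : word (gens0 D_pres) (gens1 D_pres) true).

Fact pair_subproof (X Y C : T) (D1 D2 : sharp_triangle sh X Y C) :
  sq_bd ((tri_class D1)^-1 * tri_class D2)%g == 1%g.
Proof.
have bdE (D : sharp_triangle sh X Y C) :
    sq_bd (tri_class D) = cls (- w_ob Y + w_ob C + w_ob X : word (gens0 D_pres) _ _).
  rewrite /= /tri_class wc_bdE; apply/clsP => Q g0 g1 s.
  exact/(s false)/rel_bd_tri.
by rewrite sq_bdM sq_bdV !bdE mulVg.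
Qed.

(* -[D1] + [D2] in the additive notation of K1. *)
Definition pair_elt (X Y C : T) (D1 D2 : sharp_triangle sh X Y C) : K1 :=
  Pi1 (pair_subproof D1 D2).

End DStar.

Section Diagrams33.
Variables (T : triangulated_cat) (sh : flavour T).

Record diagram33 (X' X X'' Y' Y Y'' Z' Z Z'' : T) := Diagram33 {
  rowX : sharp_triangle sh X' X X'';
  rowY : sharp_triangle sh Y' Y Y'';
  rowZ : sharp_triangle sh Z' Z Z'';
  column' : sharp_triangle sh X' Y' Z';
  column : sharp_triangle sh X Y Z;
  column'' : sharp_triangle sh X'' Y'' Z'';
  sq11 : tf column ∘ tf rowX = tf rowY ∘ tf column';
  sq12 : tf column'' ∘ ti rowX = ti rowY ∘ tf column;
  sq13 : Σₘ (tf column') ∘ tq rowX = tq rowY ∘ tf column'';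
  sq21 : ti column ∘ tf rowY = tf rowZ ∘ ti column';
  sq22 : ti column'' ∘ ti rowY = ti rowZ ∘ ti column;
  sq23 : Σₘ (ti column') ∘ tq rowY = tq rowZ ∘ ti column'';
  sq31 : tq column ∘ tf rowZ = Σₘ (tf rowX) ∘ tq column';
  sq32 : tq column'' ∘ ti rowZ = Σₘ (ti rowX) ∘ tq column;
  sq33 : Σₘ (tq column') ∘ tq rowZ + Σₘ (tq rowX) ∘ tq column'' = 0
}.

Section Coherent.
Variables (X' X X'' Y' Y Y'' Z' Z Z'' : T).
Variable D : diagram33 X' X X'' Y' Y Y'' Z' Z Z''.

Notation fX := (tf (rowX D)).  Notation qX := (tq (rowX D)).
Notation iY := (ti (rowY D)).  Notation iZ := (ti (rowZ D)).
Notation f' := (tf (column' D)).  Notation q' := (tq (column' D)).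
Notation i := (ti (column D)).    Notation i'' := (ti (column'' D)).

Definition coherent : Prop :=
  exists (W : T) (bf' : hom X W) (bfX : hom Y' W) (δ : hom X' W)
    (biX : hom W X'') (bi' : hom W Z') (ε : hom W Y) (κ : hom Z'' (Σ W)),
    let DX : tri X W Z' := Tri bf' bi' (Σₘ fX ∘ q') in
    let DY : tri Y' W X'' := Tri bfX biX (Σₘ f' ∘ qX) in
    let Dδ : tri X' W (X'' ⊕ Z') := Tri δ (col_m biX bi') (row_m qX q') in
    [/\ sharp_octahedron sh (rowX D) DX Dδ (tri_split X'' Z'),
        sharp_octahedron sh (column' D) DY Dδ (tri_split' X'' Z'),
        sharp_octahedron sh DX (Tri ε (iZ ∘ i) κ) (column D) (rowZ D)
      & sharp_octahedron sh DY (Tri ε (i'' ∘ iY) κ) (rowY D) (column'' D)].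

End Coherent.
End Diagrams33.

(* Main.v *)
Require Import Defs.
From mathcomp Require Import all_boot all_algebra.
From mathcomp Require Import boolp.

Set Implicit Arguments.
Unset Strict Implicit.
Unset Printing Implicit Defensive.

Import GRing.Theory.

Local Open Scope ring_scope.

(** A coherent 3 x 3 diagram contains four octahedra around an auxiliary object
    W. In additive notation, with X', X, ... the row and column triangles and
    S, S' the two split triangles on X'' and Z', they give in degree 1

      [X -> W] + [row X] = [delta] + [S]^X',
      [Y' -> W] + [col '] = [delta] + [S']^X',
      [W -> Y] + [X -> W] = [col] + [row Z]^X,
      [W -> Y] + [Y' -> W] = [row Y] + [col '']^Y'.

    The triangle on W -> Y is the same in the last two octahedra, because the
    square with corner Z'' commutes. Eliminating the triangles through W leaves

      [col] + [row Z]^X + [row X] - [S]^X' = [row Y] + [col '']^Y' + [col '] - [S']^X',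

    ([coherent_relation]), in which S and S' depend on the objects alone. Two
    diagrams on the same nine objects thus satisfy the same relation, with the
    generators of the second obtained from those of the first by adding elements
    of pi_1. Elements of pi_1 are central and pass through the action
    ([sq_act_ker]), so they can be collected on each side, and subtracting the
    relation of the first diagram leaves the asserted identity
    ([pi1_compare]). *)

Section StableQuadratic.
Variable C : sqmod.
Local Open Scope group_scope.
Implicit Types (x y : sq0 C) (u v w k : sq1 C) (r s t : pi1 C).

Definition sq_act x u : sq1 C := u * sq_br x (sq_bd u).

Lemma pi1_val_central u v r : u * pi1_val r * v = u * v * pi1_val r.
Proof. by rewrite -!mulgA (sq_ker_central v (pi1_valP r)). Qed.

Lemma pi1_valD r s : pi1_val (r + s)%R = pi1_val r * pi1_val s.
Proof. by []. Qed.

Lemma sq_act_ker x u r : sq_act x (u * pi1_val r) = sq_act x u * pi1_val r.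
Proof. by rewrite /sq_act sq_bdM pi1_valP mulg1 pi1_val_central. Qed.

Lemma pi1_collect x u v w k r s t :
  u * pi1_val r * sq_act x (v * pi1_val s) * (w * pi1_val t) * k =
  u * sq_act x v * w * k * pi1_val (r + s + t)%R.
Proof.
(* The action is generalized so that mulgA does not unfold it. *)
rewrite sq_act_ker !pi1_valD; move: (sq_act x v) => a.
by rewrite !mulgA (pi1_val_central u) !(pi1_val_central _ w) !(pi1_val_central _ k).
Qed.

(** Elements of pi_1 that perturb the entries of a relation of the shape found
    in [coherent_relation], without destroying it, have equal total on both
    sides. *)
Lemma pi1_compare x u v w k x' u' v' w' k' r s t r' s' t' :
    u * sq_act x v * w * k = u' * sq_act x' v' * w' * k' ->
    u * pi1_val r * sq_act x (v * pi1_val s) * (w * pi1_val t) * k =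
    u' * pi1_val r' * sq_act x' (v' * pi1_val s') * (w' * pi1_val t') * k' ->
  (r + s + t = r' + s' + t')%R.
Proof. by move=> e; rewrite !pi1_collect e => /mulgI/val_inj. Qed.

End StableQuadratic.

Section Classes.
Variables (T : triangulated_cat) (sh : flavour T).
Local Open Scope group_scope.

Definition ob_class (X : T) : sq0 (D_star sh) :=
  cls (w_ob sh X : word (gens0 (D_pres sh)) (gens1 (D_pres sh)) false).

Lemma tri_class_inj (X Y C : T) (D D1 : sharp_triangle sh X Y C) :
  D = D1 :> tri X Y C -> tri_class D = tri_class D1.
Proof.
by case: D D1 => [D h] [D1 h1] /= e; subst D1; rewrite (Prop_irrelevance h h1).
Qed.

Lemma tri_class_pair (X Y C : T) (D D1 : sharp_triangle sh X Y C) :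
  tri_class D1 = tri_class D * pi1_val (pair_elt D D1).
Proof. by rewrite /= mulVKg. Qed.

Lemma sharp_octahedron_triangles {X Y Z Cf Cg Cgf : T} {Df : tri X Y Cf}
    {Dg : tri Y Z Cg} {Dgf : tri X Z Cgf} {Dt : tri Cf Cgf Cg} :
  sharp_octahedron sh Df Dg Dgf Dt ->
  [/\ is_sharp_triangle sh Df, is_sharp_triangle sh Dg,
      is_sharp_triangle sh Dgf & is_sharp_triangle sh Dt].
Proof.
rewrite /sharp_octahedron /is_sharp_triangle.
by case: sh => [[]|[[]]|[]|st /so_octahedron[]].
Qed.

Lemma tri_class_octahedron (X Y Z Cf Cg Cgf : T)
    (Df : sharp_triangle sh X Y Cf) (Dg : sharp_triangle sh Y Z Cg)
    (Dgf : sharp_triangle sh X Z Cgf) (Dt : sharp_triangle sh Cf Cgf Cg) :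
  sharp_octahedron sh Df Dg Dgf Dt ->
  tri_class Dg * tri_class Df =
  tri_class Dgf * sq_act (ob_class X) (tri_class Dt).
Proof.
move=> o.
have /clsP : word_equiv (P := D_pres sh) (w_tri Dg + w_tri Df)%W
    (w_tri Dgf + w_tri Dt ^ w_ob sh X)%W.
  by move=> Q g0 g1 s; exact: (s true) _ _ (rel_octahedron o).
by rewrite !clsM -wc_brE -wc_bdE.
Qed.

(** Eliminating the triangles through W from the classes of the four octahedra.
    That the split triangles are sharp-triangles is itself read off the
    octahedra, hence the existential form; by [tri_class_inj] their classes do
    not depend on the diagram. *)
Lemma coherent_relation (X' X X'' Y' Y Y'' Z' Z Z'' : T)
    (D : diagram33 sh X' X X'' Y' Y Y'' Z' Z Z'') :
  coherent D ->
  exists S : sharp_triangle sh X'' (X'' ⊕ Z')%cat Z',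
  exists S' : sharp_triangle sh Z' (X'' ⊕ Z')%cat X'',
  [/\ S = tri_split X'' Z' :> tri _ _ _, S' = tri_split' X'' Z' :> tri _ _ _
    & tri_class (column D) * sq_act (ob_class X) (tri_class (rowZ D))
        * tri_class (rowX D) * (sq_act (ob_class X') (tri_class S))^-1 =
      tri_class (rowY D) * sq_act (ob_class Y') (tri_class (column'' D))
        * tri_class (column' D) * (sq_act (ob_class X') (tri_class S'))^-1].
Proof.
case=> W [bf' [bfX [dl [biX [bi' [ep [kap [o1 o2 o3 o4]]]]]]]].
(* The triangle on W -> Y is written with either composite Y -> Z''. *)
rewrite sq22 in o4.
have [_ hX hdl hS] := sharp_octahedron_triangles o1.
have [_ hY _ hS'] := sharp_octahedron_triangles o2.
have [_ hep _ _] := sharp_octahedron_triangles o3.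
exists (SharpTriangle hS), (SharpTriangle hS'); split=> //.
pose DX := SharpTriangle hX; pose DY := SharpTriangle hY.
pose Ddl := SharpTriangle hdl; pose Dep := SharpTriangle hep.
have := tri_class_octahedron (Dg:=DX) (Dgf:=Ddl) (Dt:=SharpTriangle hS) o1.
have := tri_class_octahedron (Dg:=DY) (Dgf:=Ddl) (Dt:=SharpTriangle hS') o2.
have <- := tri_class_octahedron (Df:=DX) (Dg:=Dep) o3.
have <- := tri_class_octahedron (Df:=DY) (Dg:=Dep) o4.
move=> e2 e1.
(* Both sides are [W -> Y] + [delta]. *)
rewrite -(mulgA _ (tri_class DX)) e1 -(mulgA _ (tri_class DY)) e2.
by rewrite !(mulgA (tri_class Dep)) !mulgK.
Qed.

End Classes.

Theorem proposition2p2p8 (T : triangulated_cat) (sh : flavour T)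
    (X' X X'' Y' Y Y'' Z' Z Z'' : T)
    (D1 D2 : diagram33 sh X' X X'' Y' Y Y'' Z' Z Z'')
    (coh1 : coherent D1) (coh2 : coherent D2) :
  let rhoX : K1 sh := pair_elt (rowX D1) (rowX D2) in
  let rhoY : K1 sh := pair_elt (rowY D1) (rowY D2) in
  let rhoZ : K1 sh := pair_elt (rowZ D1) (rowZ D2) in
  let kappa' : K1 sh := pair_elt (column' D1) (column' D2) in
  let kappa : K1 sh := pair_elt (column D1) (column D2) in
  let kappa'' : K1 sh := pair_elt (column'' D1) (column'' D2) in
  rhoX - rhoY + rhoZ = kappa' - kappa + kappa''.
Proof.
move=> rhoX rhoY rhoZ kappa' kappa kappa''.
have [S1 [S1' [eS1 eS1' rel1]]] := coherent_relation coh1.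
have [S2 [S2' [eS2 eS2' rel2]]] := coherent_relation coh2.
have eS : tri_class S2 = tri_class S1 by apply: tri_class_inj; rewrite eS1.
have eS' : tri_class S2' = tri_class S1' by apply: tri_class_inj; rewrite eS1'.
rewrite eS eS' (tri_class_pair (column D1) (column D2))
  (tri_class_pair (rowZ D1) (rowZ D2))
  (tri_class_pair (rowX D1) (rowX D2))
  (tri_class_pair (rowY D1) (rowY D2))
  (tri_class_pair (column'' D1) (column'' D2))
  (tri_class_pair (column' D1) (column' D2)) in rel2.
have total : kappa + rhoZ + rhoX = rhoY + kappa'' + kappa'.
  exact: pi1_compare rel1 rel2.
apply: (addrI kappa); rewrite [kappa' - kappa]addrC -[in RHS](addrA (- kappa)) addNKr.
apply: (addrI rhoY); rewrite (addrC kappa') addrA [RHS]addrA -total.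
rewrite [rhoX - rhoY + rhoZ]addrAC (addrC rhoY) addrACA subrr addr0.
by rewrite (addrC rhoX) addrA.
Qed.
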